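(* Let $t\ge 1$ be an integer, let $r=2t$, let $K$ be a field, let $R=K[X_1,\dots,X_{3t+3}]$, and let $\mathcal{I}\subset R$ be the edge ideal of the graph $B_{2t}$. Then the Krull dimension of $R/\mathcal{I}$ is $$\dim(R/\mathcal{I})=\begin{cases}\frac{3}{4}r+\frac{3}{2} & \text{if } t \text{ is odd},\\[1mm] \frac{3}{4}r+2 & \text{if } t \text{ is even}.\end{cases}$$
   Context: For an integer $t\ge 1$, $B_{2t}$ is the simple graph with vertex set $\{v_1,\dots,v_{3t+3}\}$ and edge set $\{\{v_i,v_{i+1}\} : 1\le i\le 3t+2,\ i\ne t+1,\ i\neq 2t+2\}\cup\{\{v_i,v_{i+t+1}\} : 1\le i\le 2t+2\}$ (a grid of unit squares with 2 rows and $t$ columns of squares); $r=2t$ is its number of (bounded) regions. The edge ideal of a graph on $v_1,\dots,v_n$ is the ideal of $K[X_1,\dots,X_n]$ generated by all monomials $X_iX_j$ with $\{v_i,v_j\}$ an edge. *)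

(* Defs.v *)
From HB Require Import structures.
From mathcomp Require Import all_boot all_order all_algebra.
From mathcomp Require Import ring_quotient mpoly.
From mathcomp Require Import boolp.

Set Implicit Arguments.
Unset Strict Implicit.
Unset Printing Implicit Defensive.

Import GRing.Theory.
Local Open Scope ring_scope.

Section KrullDimension.

Variable A : comNzRingType.

(* A chain P_0 < P_1 < ... < P_n of prime ideals has length n. *)
Definition prime_chain (n : nat) (P : 'I_n.+1 -> prime_idealr A) : Prop :=
  forall i j : 'I_n.+1, (i < j)%N ->
    {subset P i <= P j} /\ ~ {subset P j <= P i}.

Definition has_krull_dim (d : nat) : Prop :=
  (exists P : 'I_d.+1 -> prime_idealr A, prime_chain P) /\
  (forall (n : nat) (P : 'I_n.+1 -> prime_idealr A), prime_chain P ->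
     (n <= d)%N).

End KrullDimension.

Section GeneratedIdeal.

Variables (A : comNzRingType) (G : A -> Prop).

Definition ideal_gen : {pred A} :=
  [pred f : A | `[< exists s : seq (A * A),
    (forall c, c \in s -> G c.2) /\ f = \sum_(c <- s) c.1 * c.2 >]].

Lemma ideal_genP f :
  reflect (exists s : seq (A * A),
             (forall c, c \in s -> G c.2) /\ f = \sum_(c <- s) c.1 * c.2)
          (f \in ideal_gen).
Proof. by rewrite inE; apply: asboolP. Qed.

Lemma ideal_gen_closed : 1 \notin ideal_gen -> idealr_closed ideal_gen.
Proof.
move=> n1; split=> //.
  by apply/ideal_genP; exists [::]; split=> //; rewrite big_nil.
move=> a u v /ideal_genP[s [Gs ->]] /ideal_genP[s' [Gs' ->]].
apply/ideal_genP; exists ([seq (a * c.1, c.2) | c <- s] ++ s'); split.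
  by move=> c; rewrite mem_cat => /orP[/mapP[c0 /Gs ? ->] | /Gs'].
rewrite big_cat big_map mulr_sumr; congr (_ + _).
by apply: eq_bigr => c _; rewrite mulrA.
Qed.

End GeneratedIdeal.

Record sgraph (n : nat) := SGraph {
  edge : rel 'I_n;
  edge_sym : ssrbool.symmetric edge;
  edge_irrefl : irreflexive edge
}.

Section EdgeIdeal.

Variables (K : fieldType) (n : nat) (E : sgraph n).

Definition edge_monomial (m : {mpoly K[n]}) : Prop :=
  exists i j : 'I_n, edge E i j /\ m = 'X_i * 'X_j.

Definition edge_pred : {pred {mpoly K[n]}} := ideal_gen edge_monomial.

Lemma edge_pred1 : 1 \notin edge_pred.
Proof.
apply/ideal_genP => -[s [Gs /(congr1 (fun p => p.@[fun _ => 0]))]].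
rewrite meval1 rmorph_sum big_seq big1 => [/eqP|c /Gs[i [j [_ ->]]]].
  by rewrite oner_eq0.
by rewrite !rmorphM /= mevalXU mul0r mulr0.
Qed.

HB.instance Definition _ :=
  isIdealr.Build {mpoly K[n]} edge_pred (ideal_gen_closed edge_pred1).

Definition edge_ideal : idealr {mpoly K[n]} := edge_pred.

End EdgeIdeal.

(* [grid_pair t a b] uses the 1-based labels of v_1, ..., v_(3t+3); it holds
   when {v_a, v_b} is listed as an edge with the smaller label a first. *)
Definition grid_pair (t a b : nat) : bool :=
  [&& 1 <= a, a <= 3 * t + 2, a != t + 1, a != 2 * t + 2 & b == a + 1]%N ||
  [&& 1 <= a, a <= 2 * t + 2 & b == a + t + 1]%N.

(* The vertex v_k is the ordinal k - 1. *)
Definition grid_rel (t : nat) : rel 'I_(3 * t + 3) :=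
  fun i j => grid_pair t i.+1 j.+1 || grid_pair t j.+1 i.+1.

Lemma grid_rel_sym t : ssrbool.symmetric (@grid_rel t).
Proof. by move=> i j; rewrite /grid_rel orbC. Qed.

Lemma grid_rel_irrefl t : irreflexive (@grid_rel t).
Proof.
move=> i; rewrite /grid_rel orbb /grid_pair.
have neq k : (i.+1 == i.+1 + k.+1)%N = false.
  by rewrite -{1}[i.+1]addn0 eqn_add2l.
by rewrite -addnA [(t + 1)%N]addn1 !neq !andbF.
Qed.

Definition grid_graph (t : nat) : sgraph (3 * t + 3) :=
  SGraph (@grid_rel_sym t) (@grid_rel_irrefl t).

(* Main.v *)
(* The edge ideal lies in a prime p only if the variables outside p form an
   independent set S of vertices, so dim R/I is the independence number of the
   graph.  For an independent S, the kernels of the maps that keep only the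
   variables of a shrinking subset of S give a chain of length |S|.  Conversely
   let P_0 < ... < P_m be primes of R/I, S the set of variables outside P_0, and
   x_i in P_(i+1) but not in P_i.  If m > |S|, comparing the number of monomials
   in the x_i with the number of monomials supported in S yields a nontrivial
   K-linear relation modulo P_0 between monomials in the x_i.  Following
   Coquand and Lombardi, dividing it by the power of x_0 it contains and reducing
   modulo x_0 gives such a relation between x_1, ..., x_(m-1) modulo P_1, and so
   on until a nonzero constant lies in P_m.
   In the 3 x (t+1) grid, horizontal dominoes bound an independent set, together
   with a vertical domino in the last column when t + 1 is odd; the
   checkerboard set attains the bound. *)
Require Import Defs.
From HB Require Import structures.
From mathcomp Require Import all_boot all_order all_algebra.
From mathcomp Require Import ring_quotient mpoly boolp zify lra.

Import GRing.Theory.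
Local Open Scope ring_scope.
Local Open Scope quotient_scope.

Set Implicit Arguments.
Unset Strict Implicit.

(** * Independent sets in the 3 x (t+1) grid *)

Definition independent {n} (E : sgraph n) (S : {set 'I_n}) : Prop :=
  forall i j, i \in S -> j \in S -> ~~ edge E i j.

Section GridIndependence.
Local Open Scope nat_scope.

(** Dominoes cover the path, except for its last vertex when [w] is odd. The indicator of that
    vertex is kept instead of the cruder bound 1, so that a vertical domino can later be applied to
    it. *)
Lemma path_independent_sum (s : nat -> bool) w :
  (forall c, c.+1 < w -> ~~ (s c && s c.+1)) ->
  \sum_(c < w) s c <= w./2 + odd w && s w.-1.
Proof.
elim/ltn_ind: w => -[|[|w]] IH h; rewrite ?big_ord0 ?big_ord_recr //=.
  by rewrite big_ord0.
have := IH w (leqnSn _) (fun c hc => h c (leqW (leqW hc))).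
have := h w (leqnn _).
have : (0 < w) ==> ~~ (s w.-1 && s w).
  by case: w h {IH} => // w h; apply: h; rewrite ltnW.
rewrite negbK; case: w {IH h} => [|w] /=; first by rewrite big_ord0; lia.
by case: (odd w); case: (s w); case: (s w.+1); case: (s w.+2) => //=; lia.
Qed.

Lemma card_ord_sum n (S : {set 'I_n}) :
  #|S| = \sum_(k < n) (k \in S).
Proof. by rewrite -sum1_card big_mkcond; apply: eq_bigr => i _; case: (i \in S). Qed.

Lemma sum_three_rows w (f : nat -> nat) :
  \sum_(k < 3 * w) f k = \sum_(r < 3) \sum_(c < w) f (r * w + c).
Proof.
have -> : 3 * w = w + w + w by lia.
rewrite !big_split_ord /= !big_ord_recr big_ord0 /= add0n.
congr (_ + _ + _); apply: eq_bigr => c _; congr f; lia.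
Qed.

Lemma grid_independent_card t (S : {set 'I_(3 * t + 3)}) :
  independent (grid_graph t) S -> #|S| <= t + t./2 + 2.
Proof.
move=> indS.
(* The indicator of [S] on all of [nat], false beyond the last vertex, so that row arithmetic is
   free of ordinals. *)
pose s k := k \in [seq val i | i in S].
have sE (i : 'I_(3 * t + 3)) : s i = (i \in S).
  by rewrite /s mem_image //; exact: val_inj.
have s_indep a b : a < 3 * t + 3 -> b < 3 * t + 3 ->
    grid_pair t a.+1 b.+1 -> ~~ (s a && s b).
  move=> ha hb hab; apply/negP => /andP[].
  rewrite (sE (Ordinal ha)) (sE (Ordinal hb)) => aS bS.
  by have := indS _ _ aS bS; rewrite /= /grid_rel /= hab.
have -> : #|S| = \sum_(k < 3 * t.+1) s k.
  rewrite card_ord_sum; have -> : 3 * t.+1 = 3 * t + 3 by lia.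
  by apply: eq_bigr => i _; rewrite sE.
rewrite (sum_three_rows t.+1 s).
have horiz r c : r < 3 -> c < t -> ~~ (s (r * t.+1 + c) && s (r * t.+1 + c.+1)).
  move=> hr hc; apply: s_indep; rewrite /grid_pair; first nia.
    by nia.
  by case: r hr => [|[|[|//]]] _; lia.
have vert c : c <= t -> ~~ (s (0 * t.+1 + c) && s (1 * t.+1 + c)).
  by move=> hc; apply: s_indep; rewrite /grid_pair; lia.
have row r : r < 3 -> \sum_(c < t.+1) s (r * t.+1 + c) <=
    t.+1./2 + odd t.+1 && s (r * t.+1 + t).
  move=> hr; apply: (@path_independent_sum (fun c => s (r * t.+1 + c))).
  by move=> c hc; apply: horiz.
(* For [t] even each row leaves its last vertex over; the vertical domino in rows 0 and 1 allows at
   most two of these three in [S]. *)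
have := vert t (leqnn _).
have := row 0 isT; have := row 1 isT; have := row 2 isT.
rewrite !(@big_ord_recr _ _ _ 2) !(@big_ord_recr _ _ _ 1).
rewrite !(@big_ord_recr _ _ _ 0) big_ord0 /= uphalf_half.
move: (s (0 * _ + t)) (s (1 * _ + t)) (s (2 * _ + t)).
by case odd_t: (odd t) => -[] [] [] //=; lia.
Qed.

(** Vertex [k] has row [k %/ t.+1] and column [k %% t.+1]. The even class contains the corner 0, so
    it is the larger one when the number of vertices is odd. *)
Definition grid_checkerboard t : {set 'I_(3 * t + 3)} :=
  [set k : 'I__ | ~~ odd (k %/ t.+1 + k %% t.+1)].

Lemma grid_pair_parity t a b : a < 3 * t + 3 -> grid_pair t a.+1 b.+1 ->
  odd (b %/ t.+1 + b %% t.+1) = ~~ odd (a %/ t.+1 + a %% t.+1).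
Proof.
move=> ha /orP[/and5P[_ a_le n1 n2 /eqP ab]|/and3P[_ h /eqP ab]]; last first.
  have -> : b = 1 * t.+1 + a by lia.
  by rewrite divnMDl // modnMDl -addnA add1n.
(* The excluded labels and the bound [a_le] rule out the row ends, so the right neighbour stays in
   the same row. *)
have am : (a %% t.+1).+1 < t.+1.
  have := divn_eq a t.+1; have := ltn_pmod a (ltn0Sn t).
  have : a %/ t.+1 < 3 by rewrite ltn_divLR //; lia.
  by case: (a %/ t.+1) => [|[|[|//]]] _; move: (a %% t.+1) => u; lia.
have -> : b = a %/ t.+1 * t.+1 + (a %% t.+1).+1 by have := divn_eq a t.+1; lia.
by rewrite divnMDl // modnMDl (divn_small am) (modn_small am) addn0 addnS.
Qed.

Lemma grid_checkerboard_independent t :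
  independent (grid_graph t) (grid_checkerboard t).
Proof.
move=> i j; rewrite !inE /= /grid_rel => iS jS; apply/negP.
case/orP=> /grid_pair_parity par; first by rewrite (par (ltn_ord i)) iS in jS.
by rewrite (par (ltn_ord j)) jS in iS.
Qed.

Lemma sum_parity w (b : bool) :
  \sum_(c < w) ~~ (b (+) odd c) = if b then w./2 else uphalf w.
Proof.
elim: w => [|w IH]; first by rewrite big_ord0; case: b.
by rewrite big_ord_recr /= IH; case: b {IH} => /=; lia.
Qed.

Lemma card_grid_checkerboard t : #|grid_checkerboard t| = t + t./2 + 2.
Proof.
rewrite card_ord_sum.
under eq_bigr do rewrite inE.
have -> : 3 * t + 3 = 3 * t.+1 by lia.
rewrite (sum_three_rows t.+1 (fun k => ~~ odd (k %/ t.+1 + k %% t.+1))).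
transitivity (\sum_(r < 3) \sum_(c < t.+1) ~~ (odd r (+) odd c)).
  apply: eq_bigr => r _; apply: eq_bigr => c _.
  by rewrite divnMDl // modnMDl modn_small ?divn_small // addn0 oddD.
under eq_bigr do rewrite sum_parity.
rewrite !big_ord_recr big_ord0 /=; lia.
Qed.

End GridIndependence.

(** * Lexicographically least monomials and chains of primes *)

Fixpoint exponents (M n : nat) : seq (seq nat) :=
  if n is n'.+1 then [seq i :: e | i <- iota 0 M, e <- exponents M n']
  else [:: [::]].

Lemma size_exponents M n : size (exponents M n) = (M ^ n)%N.
Proof. by elim: n => //= n IH; rewrite size_allpairs size_iota IH expnS. Qed.

Lemma uniq_exponents M n : uniq (exponents M n).
Proof.
elim: n => //= n IH; apply: allpairs_uniq; rewrite ?iota_uniq //.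
by move=> [i e] [j e'] _ _ /= [-> ->].
Qed.

Section AlgebraicDependence.
Variable A : comNzRingType.

Fixpoint monomial (xs : seq A) (e : seq nat) : A :=
  match xs, e with
  | x :: xs', i :: e' => x ^+ i * monomial xs' e'
  | _, _ => 1
  end.

(* The shape of a nonzero polynomial expression in [xs] with unit coefficients
   once its lexicographically least monomial is factored out; the cofactor [h]
   is arbitrary in [A], since only its multiplication by [x] matters. *)
Fixpoint lex_form (xs : seq A) (f : A) : Prop :=
  if xs is x :: xs' then
    exists m g h, lex_form xs' g /\ f = x ^+ m * (g + x * h)
  else exists g, g * f = 1.

(** Collect the terms by the power of [x], and let [m] be the least power whose slice has a nonzero
    coefficient. Lower slices vanish, the slice at [m] is treated by induction, and all higher ones
    are divisible by [x ^+ m.+1] and form the cofactor. *)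
Lemma lex_form_sum M (xs : seq A) (c : seq nat -> A) :
  (forall e, c e = 0 \/ exists g, g * c e = 1) ->
  (exists2 e, e \in exponents M (size xs) & c e != 0) ->
  lex_form xs (\sum_(e <- exponents M (size xs)) c e * monomial xs e).
Proof.
elim: xs c => [|x xs IH] c c_unit [e he ce].
  move: he; rewrite inE => /eqP e0; rewrite e0 in ce.
  rewrite /= big_seq1 mulr1; case: (c_unit [::]) => // c0.
  by rewrite c0 eqxx in ce.
pose g i := \sum_(e' <- exponents M (size xs)) c (i :: e') * monomial xs e'.
have fE : \sum_(e <- exponents M (size (x :: xs))) c e * monomial (x :: xs) e
    = \sum_(0 <= i < M) x ^+ i * g i.
  rewrite /= big_allpairs_dep /index_iota subn0; apply: eq_bigr => i _.
  by rewrite mulr_sumr; apply: eq_bigr => e' _; rewrite mulrCA.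
have exm : exists i, (i < M)%N &&
    has (fun e' => c (i :: e') != 0) (exponents M (size xs)).
  case/allpairsP: he => -[i e'] /= [+ he' ee]; rewrite mem_iota /= add0n => iM.
  by exists i; rewrite iM; apply/hasP; exists e' => //; rewrite -ee.
case: (ex_minnP exm) => m /andP[mM /hasP[e' he' ce']] mmin.
rewrite fE; exists m, (g m), (\sum_(m.+1 <= i < M) x ^+ (i - m.+1) * g i).
split; first by apply: IH => //; exists e'.
rewrite (big_cat_nat (n := m)) //=; last exact: ltnW.
rewrite big_nat big1 ?add0r => [|i /andP[_ im]]; last first.
  rewrite /g big_seq big1 ?mulr0 // => s hs.
  case: (eqVneq (c (i :: s)) 0) => [->|ci]; first by rewrite mul0r.
  have := mmin i; rewrite (ltn_trans im mM) leqNgt im /=.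
  suff -> : has (fun e' => c (i :: e') != 0) (exponents M (size xs)).
    by move=> /(_ isT).
  by apply/hasP; exists s.
rewrite big_ltn // mulrDr mulrA -exprSr; congr (_ + _).
rewrite mulr_sumr big_nat [RHS]big_nat; apply: eq_bigr => i /andP[mi _].
by rewrite mulrA -exprD subnKC.
Qed.

(** If [x ^+ m * (g + x * h)] lies in a prime omitting [x], so does [g + x * h]; the next prime
    contains this element and [x], hence [g]. At the end of the chain a unit would lie in a
    prime. *)
Lemma lex_form_prime_chain n (P : 'I_n.+1 -> prime_idealr A) (xs : seq A) f :
  prime_chain P -> size xs = n ->
  (forall i : nat, (i < n)%N -> xs`_i \notin P (inord i) /\
                                 xs`_i \in P (inord i.+1)) ->
  lex_form xs f -> f \notin P ord0.
Proof.
move=> chainP sz hx.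
(* Generalised to suffixes of [xs]: dropping a generator goes with one step up the chain. *)
suff H (ys : seq A) k g : (k + size ys = n)%N -> ys = drop k xs -> lex_form ys g ->
    g \notin P (inord k).
  move=> hf; have -> : ord0 = inord 0 :> 'I_n.+1.
    by apply/val_inj; rewrite /= inordK.
  by apply: (H xs) => //; rewrite drop0.
elim: ys k g => [|y ys IH] k g /= kn ys_drop.
  move=> [h hg]; apply/negP => /(idealMr h); rewrite hg.
  by rewrite idealr1.
have kn' : (k < n)%N by lia.
have ltxs : (k < size xs)%N by rewrite sz.
move: ys_drop; rewrite (drop_nth 0) // => -[yE ysE].
have [xk xk1] := hx _ kn'.
move=> [m [g' [h [g'_form ->]]]]; apply/negP => hP.
have := IH k.+1 g' ltac:(lia) ysE g'_form => /negP; apply.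
have hP' : g' + y * h \in P (inord k).
  move: hP; rewrite prime_idealrM => /orP[|//].
  elim: m => [|m IHm]; first by rewrite expr0 idealr1.
  by rewrite exprS prime_idealrM yE (negbTE xk) /= -yE.
have lt_kk : ((inord k : 'I_n.+1) < (inord k.+1 : 'I_n.+1))%N by rewrite !inordK; lia.
have hP1 := (chainP _ _ lt_kk).1 _ hP'.
rewrite -[g'](addrK (y * h)) rpredB // mulrC idealMr // yE //.
Qed.

End AlgebraicDependence.

(** * Linear relations by counting monomials *)

Section Counting.
Variables (K : fieldType) (n : nat).
Implicit Types (xs : seq {mpoly K[n]}) (S : {set 'I_n}).

(** [msize] is the total degree plus one, and 0 for the zero polynomial; a bound [a.+1] thus means
    degree at most [a]. *)
Lemma msize_mul_le (p q : {mpoly K[n]}) a b :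
  (msize p <= a.+1 -> msize q <= b.+1 -> msize (p * q) <= (a + b).+1)%N.
Proof.
have [->|p0] := eqVneq p 0; first by rewrite mul0r msize0.
have [->|q0] := eqVneq q 0; first by rewrite mulr0 msize0.
move=> hp hq; rewrite msizeM //; move: (msize p) (msize q) hp hq; lia.
Qed.

Lemma msize_exp_le (x : {mpoly K[n]}) D i :
  (msize x <= D.+1 -> msize (x ^+ i) <= (i * D).+1)%N.
Proof.
move=> hx; elim: i => [|i IH]; first by rewrite expr0 msize1.
by rewrite exprS mulSn msize_mul_le.
Qed.

Lemma msize_monomial xs D M e :
  all (fun x => msize x <= D.+1)%N xs -> e \in exponents M (size xs) ->
  (msize (monomial xs e) <= (size xs * (M * D)).+1)%N.
Proof.
elim: xs e => [|x xs IH] e /=; first by rewrite msize1.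
move=> /andP[hx hxs] /allpairsP[[i e'] [/= + he' ->]] /=.
rewrite mem_iota add0n => /= iM.
rewrite mulSn; apply: msize_mul_le; last exact: IH.
apply: leq_trans (msize_exp_le i hx) _.
by rewrite ltnS leq_mul2r ltnW ?orbT.
Qed.

(** The left side is at most [(s * D).+1 ^ d * M ^ d], so any [M] above [(s * D).+1 ^ d] makes it
    smaller than [M ^ d.+1]. *)
Lemma more_monomials_than_multidegrees d s D :
  (d < s)%N -> exists M, ((s * (M * D)).+1 ^ d < M ^ s)%N.
Proof.
move=> ds; set M := ((s * D).+1 ^ d).+1; exists M.
have M0 : (0 < M)%N by [].
apply: (@leq_ltn_trans (((s * D).+1 * M) ^ d)).
  have [->|d0] := posnP d; rewrite ?expn0 // leq_exp2r //.
  by rewrite [(M * D)%N]mulnC mulnA mulSn; lia.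
apply: (@leq_trans (M ^ d.+1)); last by rewrite leq_pexp2l.
by rewrite expnMn expnS ltn_pmul2r ?expn_gt0.
Qed.

(** A matrix with one row per exponent list and one column per multidegree supported in [S] with
    entries at most [L] has more rows than columns, hence a nonzero left kernel vector. Coefficients
    off [S] are left uncontrolled. *)
Lemma polynomial_relation S xs : (#|S| < size xs)%N ->
  exists M (c : seq nat -> K),
    (exists2 e, e \in exponents M (size xs) & c e != 0) /\
    forall m : 'X_{1..n}, (forall i, i \notin S -> m i = 0%N) ->
      (\sum_(e <- exponents M (size xs)) (c e)%:MP * monomial xs e)@_m = 0.
Proof.
move=> ltSxs.
pose D := \max_(x <- xs) msize x.
have hD : all (fun x => msize x <= D.+1)%N xs.
  by apply/allP => x hx; rewrite leqW // /D; apply: leq_bigmax_seq.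
have [M hM] := more_monomials_than_multidegrees D ltSxs.
set L := (size xs * (M * D))%N in hM.
set ex := exponents M (size xs).
(* Multidegrees as finite functions, with value 0 outside [S]. *)
pose F := [set f in pffun_on (ord0 : 'I_L.+1) (mem S) predT].
have cardF : #|F| = (L.+1 ^ #|S|)%N by rewrite cardsE card_pffun_on card_ord.
pose A := \matrix_(a < size ex, b < #|F|)
  (monomial xs (nth [::] ex a))@_[multinom val (enum_val b j) | j < n].
have kerA : kermx A != 0.
  rewrite -mxrank_eq0 mxrank_ker -lt0n subn_gt0.
  apply: leq_ltn_trans (rank_leq_col A) _.
  by rewrite cardF size_exponents.
have [v] := rowV0Pn kerA; rewrite sub_kermx => /eqP vA v0.
(* Moves [v] from row indices to exponent lists; for a listed [e] the sum has one term, as the lists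
   are distinct. *)
pose c (e : seq nat) := \sum_(a < size ex | nth [::] ex a == e) v 0 a.
have cE (a : 'I_(size ex)) : c (nth [::] ex a) = v 0 a.
  rewrite /c (big_pred1 a) // => b /=.
  by rewrite nth_uniq ?uniq_exponents.
exists M, c; split.
  have [j vj] : exists j, v 0 j != 0.
    by apply/existsP; rewrite -negb_forall; apply: contra v0 => /forallP h;
       apply/eqP/rowP => j; rewrite mxE; apply/eqP.
  by exists (nth [::] ex j); rewrite ?mem_nth // cE.
move=> m mS; rewrite raddf_sum (big_nth [::]) big_mkord /=.
under eq_bigr => a _ do rewrite mcoeffCM cE.
have [small|big] := boolP [forall j, (m j < L.+1)%N].
  pose f := [ffun j => inord (m j) : 'I_L.+1].
  have fF : f \in F.
    rewrite inE; apply/pffun_onP; split=> //.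
    apply/supportP => j jS; rewrite ffunE mS //.
    by apply/val_inj; rewrite /= inordK.
  transitivity ((v *m A) 0 (enum_rank_in fF f)); last by rewrite vA mxE.
  rewrite mxE; apply: eq_bigr => a _; rewrite mxE enum_rankK_in //.
  congr (_ * _@_ _); apply/mnmP => j.
  by rewrite mnmE ffunE /= inordK // (forallP small j).
(* An entry of [m] above [L] exceeds the degree of every monomial in [xs]. *)
apply: big1 => a _; rewrite memN_msupp_eq0 ?mulr0 //.
apply: contra big => /msize_mdeg_lt hm; apply/forallP => j.
have aex : nth [::] ex a \in ex by rewrite mem_nth.
rewrite ltnS (@leq_trans (mdeg m)) //; first by rewrite mdegE (bigD1 j) //= leq_addr.
by rewrite -ltnS; apply: leq_trans hm (msize_monomial hD aex).
Qed.

End Counting.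

(** * Primes of a quotient as kernels of maps to domains *)

Section QuotientKernel.
Variables (R : comNzRingType) (I : idealr R) (B : idomainType).
Variable phi : {rmorphism R -> B}.
Hypothesis phi_ideal : forall f, f \in I -> phi f = 0.

(** The kernel of the map induced by [phi], read off on chosen representatives; [mem_quot_ker] shows
    that the choice is immaterial when [phi] kills [I]. *)
Definition quot_ker : {pred {ideal_quot I}} := [pred q | phi (repr q) == 0].

Lemma mem_quot_ker f : (\pi_{ideal_quot I} f \in quot_ker) = (phi f == 0).
Proof.
rewrite inE; congr (_ == _); apply/eqP.
rewrite -subr_eq0 -rmorphB phi_ideal //.
by rewrite Quotient.idealrBE reprK.
Qed.

Lemma quot_ker_idealr_closed : idealr_closed quot_ker.
Proof.
split=> [||a u v].
- by rewrite -pi_zeror mem_quot_ker rmorph0.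
- by rewrite -pi_oner mem_quot_ker rmorph1 oner_eq0.
- rewrite -[a]reprK -[u]reprK -[v]reprK -pi_mulr -pi_addr !mem_quot_ker.
  by rewrite rmorphD rmorphM => /eqP-> /eqP->; rewrite mulr0 addr0.
Qed.

Lemma quot_ker_prime : prime_idealr_closed quot_ker.
Proof.
move=> u v; rewrite -[u]reprK -[v]reprK -pi_mulr !mem_quot_ker.
by rewrite rmorphM mulf_eq0.
Qed.

HB.instance Definition _ := isIdealr.Build _ quot_ker quot_ker_idealr_closed.
HB.instance Definition _ := isPrimeIdealrClosed.Build _ quot_ker quot_ker_prime.

Definition quot_ker_prime_idealr : prime_idealr {ideal_quot I} := quot_ker.

End QuotientKernel.

(** * Krull dimension of an edge ideal quotient as an independence number *)

Section EdgeIdealDimension.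
Variables (K : fieldType) (n : nat) (E : sgraph n).
Local Notation I := (edge_ideal K E).
Local Notation A := {ideal_quot I}.

Lemma edge_ideal_mem i j : edge E i j -> 'X_i * 'X_j \in I.
Proof.
move=> eij; apply/ideal_genP; exists [:: (1, 'X_i * 'X_j)]; split.
  by move=> c; rewrite inE => /eqP->; exists i, j.
by rewrite big_seq1 mul1r.
Qed.

Definition restrict (T : {set 'I_n}) : {mpoly K[n]} -> {mpoly K[n]} :=
  mmap (@mpolyC n K) (fun i => if i \in T then 'X_i else 0).

HB.instance Definition _ T := GRing.RMorphism.on (restrict T).

Lemma restrictX T i : restrict T 'X_i = if i \in T then 'X_i else 0.
Proof. by rewrite /restrict mmapX mmap1U. Qed.

Lemma restrict_edge_ideal T f : independent E T -> f \in I -> restrict T f = 0.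
Proof.
move=> indT /ideal_genP[s [Gs ->]]; rewrite rmorph_sum big_seq big1 // => c.
move=> /Gs[i [j [eij ->]]]; rewrite !rmorphM /= !restrictX.
case: ifP => iT; last by rewrite mul0r mulr0.
case: ifP => jT; last by rewrite !mulr0.
by have := indT _ _ iT jT; rewrite eij.
Qed.

(** Yields the inclusion of kernels: what vanishes on [T'] vanishes on the smaller [T]. *)
Lemma restrict_restrict (T T' : {set 'I_n}) f : T \subset T' ->
  restrict T (restrict T' f) = restrict T f.
Proof.
move=> TT'; elim/mpolyind: f => [|c m p _ _ IH]; first by rewrite !rmorph0.
rewrite !rmorphD /= IH; congr (_ + _).
rewrite -mul_mpolyC !rmorphM /=; congr (_ * _); first by rewrite /restrict !mmapC.
rewrite mpolyXE_id !rmorph_prod /=; apply: eq_bigr => i _.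
rewrite !rmorphXn /= !restrictX; case: (boolP (i \in T')) => iT'.
  by rewrite restrictX.
by rewrite rmorph0 ifN //; apply: contra iT'; apply: (subsetP TT').
Qed.

Lemma edge_quotient_chain (S : {set 'I_n}) : independent E S ->
  exists P : 'I_#|S|.+1 -> prime_idealr A, prime_chain P.
Proof.
move=> indS.
(* These sets shrink from [S] to the empty set, so their kernels grow. *)
pose T k : {set 'I_n} := [set x in drop k (enum S)].
have TS k : T k \subset S.
  by apply/subsetP => x; rewrite inE => /mem_drop; rewrite mem_enum.
have indT k : independent E (T k).
  by move=> i j /(subsetP (TS k)) iS /(subsetP (TS k)); apply: indS.
have [P memP] : exists P : 'I_#|S|.+1 -> prime_idealr A, forall k f,
    (\pi_A f \in P k) = (restrict (T k) f == 0).
  exists (fun k => @quot_ker_prime_idealr _ I _ (restrict (T k))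
    (fun f => @restrict_edge_ideal (T k) f (indT k))) => k f.
  by apply: mem_quot_ker => g; apply: restrict_edge_ideal.
exists P => i j ij; split.
  move=> q; rewrite -[q]reprK !memP => /eqP h.
  have TT : T j \subset T i.
    apply/subsetP => x; rewrite !inE -[in drop j _](subnK (ltnW ij)) -drop_drop.
    exact: mem_drop.
  by rewrite -(restrict_restrict _ TT) h rmorph0.
have iS : (i < size (enum S))%N by rewrite -cardE; have := ltn_ord j; lia.
have [x0 _] : exists x, x \in enum S.
  by case: (enum S) iS => // x s _; exists x; rewrite mem_head.
(* The [i]-th vertex is in [T i] but already dropped from [T j], so its variable separates the two
   primes. *)
set x := nth x0 (enum S) i => /(_ (\pi 'X_x)).
have xTi : x \in T i by rewrite inE (drop_nth x0) // mem_head.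
have xTj : x \notin T j.
  rewrite inE; apply/negP => xj.
  have := enum_uniq (mem S); rewrite -(cat_take_drop j (enum S)) cat_uniq.
  case/and3P=> _ /hasP + _; apply; exists x => //.
  by rewrite /x -(nth_take x0 ij) mem_nth // size_take; case: ifP.
rewrite !memP !restrictX xTi (negbTE xTj) eqxx => /(_ isT).
move=> /eqP/mpolyP/(_ U_(x)%MM)/eqP.
by rewrite mcoeffX eqxx mcoeff0 oner_eq0.
Qed.

Lemma edge_quotient_chain_le d m (P : 'I_m.+1 -> prime_idealr A) :
  (forall S, independent E S -> #|S| <= d)%N -> prime_chain P -> (m <= d)%N.
Proof.
move=> hd chainP; rewrite leqNgt; apply/negP => dm.
pose S := [set i : 'I_n | \pi_A 'X_i \notin P ord0].
have indS : independent E S.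
  move=> i j; rewrite !inE => iS jS; apply/negP => /edge_ideal_mem.
  rewrite -[_ * _]subr0 Quotient.idealrBE => /eqP; rewrite pi_mulr pi_zeror => h.
  have := prime_idealrM (P ord0) (\pi_A 'X_i) (\pi_A 'X_j).
  by rewrite h idealr0 (negbTE iS) (negbTE jS).
have x_ex (k : nat) : exists y : A, (k < m)%N ->
    y \notin P (inord k) /\ y \in P (inord k.+1).
  (* The value 0 for [k >= m] only makes the choice function total. *)
  have [km|] := boolP (k < m)%N; last by exists 0.
  have lt_k : ((inord k : 'I_m.+1) < (inord k.+1 : 'I_m.+1))%N by rewrite !inordK; lia.
  have [_ /existsNP[y /not_implyP[y1 y0]]] := chainP _ _ lt_k.
  by exists y => _; split=> //; apply/negP.
have [x hx] := choice x_ex.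
pose xs := mkseq x m.
pose ys : seq {mpoly K[n]} := map repr xs.
have size_ys : size ys = size xs by rewrite size_map.
have [M [c [c_neq0 c_rel]]] : exists M (c : seq nat -> K),
    (exists2 e, e \in exponents M (size ys) & c e != 0) /\
    forall m : 'X_{1..n}, (forall i, i \notin S -> m i = 0%N) ->
      (\sum_(e <- exponents M (size ys)) (c e)%:MP * monomial ys e)@_m = 0.
  apply: polynomial_relation; rewrite size_ys size_mkseq.
  exact: leq_ltn_trans (hd _ indS) dm.
set f := \sum_(e <- _) _ in c_rel.
(* Monomials of [f] supported in [S] have coefficient 0; any other contains a variable that lies in
   [P ord0]. *)
have f_P0 : \pi_A f \in P ord0.
  rewrite [f]mpolyE rmorph_sum /= big_seq rpred_sum // => mm hmm.
  have [j jS mj] : exists2 j, j \notin S & mm j != 0%N.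
    have : ~ (forall i, i \notin S -> mm i = 0%N).
      by move=> /c_rel h; rewrite mcoeff_msupp h eqxx in hmm.
    by move=> /existsNP[j /not_implyP[jS /eqP mj]]; exists j.
  have Xj : \pi_A 'X_j \in P ord0 by move: jS; rewrite inE negbK.
  have -> : mm = (mm - U_(j) + U_(j))%MM by rewrite submK // lep1mP.
  by rewrite mpolyXD -mul_mpolyC mulrA pi_mulr idealMr.
have pi_monomial e : \pi_A (monomial ys e) = monomial xs e.
  rewrite /ys; elim: (xs) e => [|z zs IH] [|i e] /=; rewrite ?pi_oner //.
  by rewrite pi_mulr IH rmorphXn /= reprK.
have pi_inv e : c e != 0 -> \pi_A (c e)^-1%:MP * \pi_A (c e)%:MP = 1.
  by move=> ce; rewrite -pi_mulr -mpolyCM mulVf // pi_oner.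
(* The same element, rewritten as a relation in [xs] with zero or unit coefficients, must lie
   outside [P ord0]. *)
have := @lex_form_prime_chain _ _ P xs (\pi_A f) chainP (size_mkseq _ _).
move=> /(_ _ _)/negP; apply=> //.
  by move=> k km; rewrite nth_mkseq //; apply: hx.
rewrite rmorph_sum /= size_ys.
under eq_bigr => e _ do rewrite pi_mulr pi_monomial.
apply: lex_form_sum => [e|].
  have [->|ce] := eqVneq (c e) 0; first by left; rewrite mpolyC0 pi_zeror.
  by right; exists (\pi_A (c e)^-1%:MP); apply: pi_inv.
case: c_neq0 => e he ce; exists e; rewrite -?size_ys //.
apply/negP => /eqP ce0; move/eqP: (pi_inv e ce).
by rewrite ce0 mulr0 eq_sym oner_eq0.
Qed.

Lemma krull_dim_edge_ideal d :
  (exists2 S : {set 'I_n}, independent E S & #|S| = d) ->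
  (forall S, independent E S -> #|S| <= d)%N -> has_krull_dim A d.
Proof.
move=> [S indS <-] Sd; split; first exact: edge_quotient_chain.
by move=> m P; apply: edge_quotient_chain_le.
Qed.

End EdgeIdealDimension.

Theorem proposition3p5 (t : nat) (ht : (1 <= t)%N) (K : fieldType) :
  let r := (2 * t)%N in
  exists d : nat,
    has_krull_dim {ideal_quot (edge_ideal K (grid_graph t))} d /\
    (d%:R : rat) = if odd t then 3 / 4 * r%:R + 3 / 2 else 3 / 4 * r%:R + 2.
Proof.
move=> r; exists (t + t./2 + 2)%N; split.
  apply: krull_dim_edge_ideal; last exact: grid_independent_card.
  exists (grid_checkerboard t); last exact: card_grid_checkerboard.
  exact: grid_checkerboard_independent.
(* Makes both sides linear in [t./2] once the parity is fixed. *)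
have tE : t%:R = (odd t)%:R + 2 * (t./2)%:R :> rat.
  by rewrite -natrM -natrD mul2n odd_double_half.
by rewrite /r natrM !natrD tE; case: (odd t) => /=; lra.
Qed.
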